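(* Let $p$ be a prime, let $s,r\ge1$ be integers, $q=p^r$, $L=GR(p^s,r)$, and let $m$ be a positive integer such that $rm\ge s$. Let $0\le\nu<m(q-1)$. Then $$RM_L(\nu,m)^{\bot}=RM_L(\mu,m),\qquad\text{where }\mu=m(q-1)-\nu-1.$$
   Context: $L=GR(p^s,r)$ is the Galois ring of characteristic $p^s$ with $p^{sr}$ elements; it is local with maximal ideal $pL$ and residue field $\mathbb{F}_q$. Put $n=q^m-1$. Let $h(x)\in L[x]$ be a monic basic primitive polynomial of degree $m$ (i.e. its reduction mod $p$ is a primitive polynomial over $\mathbb{F}_q$) dividing $x^{n}-1$, with a root $\xi$ of multiplicative order $n$ in $\mathcal{R}=L[x]/(h(x))=GR(p^s,rm)$. Then $\{1,\xi,\dots,\xi^{m-1}\}$ is an $L$-basis of $\mathcal{R}$. For $0\le i\le n-1$ write uniquely $\xi^i=b_{1i}+b_{2i}\xi+\dots+b_{mi}\xi^{m-1}$ with $b_{ji}\in L$, and set $b_i=(b_{1i},\dots,b_{mi})\in L^m$, $b_\infty=(0,\dots,0)$. For $P\in L[x_1,\dots,x_m]$ let $ev(P)=(P(b_\infty),P(b_0),P(b_1),\dots,P(b_{n-1}))\in L^{q^m}$. The generalized Reed-Muller code of order $\nu$ ($0\le\nu\le m(q-1)$) over $L$ is $$RM_L(\nu,m)=\{ev(P)\mid P\in L[x_1,\dots,x_m],\ \deg_{x_i}P\le q-1\ (1\le i\le m),\ \deg P\le\nu\},$$ where $\deg$ is the total degree and $\deg 0=-\infty$. For a code $C\subseteq L^{q^m}$,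 $C^\bot$ is the dual code with respect to the standard inner product $u\cdot v=\sum_i u_iv_i$ on $L^{q^m}$. *)

(* Defs.v *)
From HB Require Import structures.
From mathcomp Require Import all_boot all_order all_algebra all_field.
From mathcomp Require Import mpoly.

Set Implicit Arguments.
Unset Strict Implicit.
Unset Printing Implicit Defensive.

Import GRing.Theory.
Local Open Scope ring_scope.

(* L is (a model of) GR(p^s, r), for p prime and s, r >= 1. These properties
   determine L up to isomorphism. *)
Record galois_ring (p s r : nat) (L : finComUnitRingType) : Prop := GaloisRing {
  galois_ring_char : forall k : nat, k%:R = 0 :> L <-> (p ^ s %| k)%N;
  galois_ring_card : #|L| = (p ^ (s * r))%N;
  (* L is local with maximal ideal pL *)
  galois_ring_local :
    forall x : L, x \isn't a GRing.unit <-> exists y : L, x = p%:R * y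
}.

(* pi identifies F with the residue field L / pL. *)
Definition residue_map (p : nat) (L : finComUnitRingType) (F : finFieldType)
    (pi : {rmorphism L -> F}) : Prop :=
  (forall y : F, exists x : L, pi x = y) /\
  (forall x : L, pi x = 0 <-> exists y : L, x = p%:R * y).

(* g is the minimal polynomial over F of a generator of the multiplicative
   group of the extension K of F of degree m. *)
Definition primitive_poly (m : nat) (F : finFieldType) (g : {poly F}) : Prop :=
  exists (K : fieldExtType F) (a : K),
    [/\ \dim {:K} = m,
        (#|F| ^ m - 1)%N.-primitive_root a &
        map_poly (in_alg K) g = minPoly 1%AS a].

Definition monic_basic_primitive (p m : nat) (L : finComUnitRingType)
    (h : {poly L}) : Prop :=
  [/\ h \is monic,
      size h = m.+1 &
      exists (F : finFieldType) (pi : {rmorphism L -> F}),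
        residue_map p pi /\ primitive_poly m (map_poly pi h)].

(* b i is the vector of coordinates of x ^+ i in 1, x, ..., x ^+ (m - 1), for
   i < n; the values of b beyond n are irrelevant. *)
Definition power_coords (m n : nat) (L : comNzRingType) (R : lalgType L)
    (x : R) (b : nat -> 'I_m -> L) : Prop :=
  forall i : nat, (i < n)%N -> x ^+ i = \sum_(j < m) b i j *: x ^+ j.

(* The points in the order b_oo = 0, b_0, b_1, ... *)
Definition point (m : nat) (L : comNzRingType) (b : nat -> 'I_m -> L)
    (k : nat) : 'I_m -> L :=
  if k is i.+1 then b i else fun=> 0.

Definition ev (m N : nat) (L : comNzRingType) (b : nat -> 'I_m -> L)
    (P : {mpoly L[m]}) : 'rV[L]_N :=
  \row_(k < N) P.@[point b k].

(* msize P is one more than the total degree of P, and 0 if P = 0. *)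
Definition RM (q m nu : nat) (L : comNzRingType) (b : nat -> 'I_m -> L)
    (c : 'rV[L]_(q ^ m)) : Prop :=
  exists P : {mpoly L[m]},
    [/\ forall M : 'X_{1..m}, M \in msupp P -> forall i : 'I_m, (M i <= q - 1)%N,
        (msize P <= nu.+1)%N &
        c = ev (q ^ m) b P].

Definition dual_code (N : nat) (L : comNzRingType) (C : 'rV[L]_N -> Prop)
    (u : 'rV[L]_N) : Prop :=
  forall v : 'rV[L]_N, C v -> \sum_(k < N) u 0 k * v 0 k = 0.

(* Main.v *)
Require Import Defs.
From HB Require Import structures.
From mathcomp Require Import all_boot all_order all_algebra all_field.
From mathcomp Require Import mpoly.
From mathcomp Require Import perm zify.

Set Implicit Arguments.
Unset Strict Implicit.
Unset Printing Implicit Defensive.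

Import GRing.Theory.
Local Open Scope ring_scope.

(* Let R = L[X]/h, with residue field K, and let q^t act on xi by conjugation,
   xi |-> xi^(q^t). The coordinates b_ji of xi^i are L-linear in xi^i, hence,
   inverting the Vandermonde matrix of the conjugates of xi, they are linear
   combinations of the xi^(i q^t), t < m. So a monomial of degree d > 0 at the
   point b_i is a combination of powers xi^(i e), where e is a sum of d powers
   of q. Summing over i kills all e not divisible by q^m - 1, and no multiple
   of q^m - 1 is a sum of d powers of q with 0 < d < m(q - 1). Monomials of
   degree 0 sum to q^m = 0, because s <= rm. Thus monomials of degree less than
   m(q - 1) sum to zero over all points, which gives one inclusion.
   For the other, the reduced monomials evaluate to a basis of L^(q^m), since
   modulo p the points are all of F_q^m. Pairing each monomial with its
   complement x^((q-1,...,q-1) - alpha), the Gram matrix is invertible and block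
   triangular, so a word orthogonal to RM(nu) has no component of degree
   greater than mu. *)

(** * Projections and block triangular matrices *)

(** Since [G D = D G D], the block [D H D] is a left inverse of [D G D] relative to the identity
    [D]. Adding [C = 1 - D] to both gives full square matrices, where a left inverse is a right
    inverse, so [a D = a D G D H D = a G D H D = 0]. *)
Lemma block_triangular_ker (R : comUnitRingType) (n : nat)
    (G H D : 'M[R]_n) (a : 'rV[R]_n) :
  H *m G = 1%:M -> D *m D = D -> (1%:M - D) *m G *m D = 0 ->
  a *m G *m D = 0 -> a *m D = 0.
Proof.
move=> HG DD tri aGD.
have GD : D *m G *m D = G *m D.
  by apply/esym/eqP; rewrite -subr_eq0 -!mulmxA -[X in X - _]mul1mx -mulmxBl mulmxA tri.
have HD : D *m H *m D *m (D *m G *m D) = D.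
  rewrite !mulmxA -(mulmxA (D *m H) D D) DD -(mulmxA (D *m H) D G).
  by rewrite -(mulmxA (D *m H)) GD mulmxA -(mulmxA D H G) HG mulmx1 DD.
have [C defC] : {C | C = 1%:M - D} by exists (1%:M - D).
have DC : D *m C = 0 by rewrite defC mulmxBr mulmx1 DD subrr.
have CD : C *m D = 0 by rewrite defC mulmxBl mul1mx DD subrr.
have CC : C *m C = C by rewrite {1}defC mulmxBl mul1mx DC subr0.
have : (D *m H *m D + C) *m (D *m G *m D + C) = 1%:M.
  rewrite mulmxDl !mulmxDr HD CC -(mulmxA _ D C) DC mulmx0 addr0.
  by rewrite !mulmxA CD !mul0mx add0r defC addrC subrK.
move/mulmx1C/(congr1 (mulmx D)).
rewrite mulmxDl !mulmxDr CC DC addr0 -(mulmxA _ D C) DC !mulmxA.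
rewrite !(DC, DD, mul0mx, mulmx0, addr0) mulmx1 => GHD.
by rewrite -GHD -(mulmxA (_ *m _)) !mulmxA -(mulmxA a) -(mulmxA a) GD mulmxA aGD !mul0mx.
Qed.

(** * Divisibility of sums of powers of q by q^m - 1 *)

Lemma sum_exp_cyclic_shift (q m t : nat) : (0 < m)%N ->
  (\sum_(j < m) q ^ ((t + j) %% m) = \sum_(j < m) q ^ j)%N.
Proof.
case: m => // m _.
rewrite [RHS](reindex_inj (@addrI 'I_m.+1 (inZp t))) /=.
by apply: eq_bigr => j _; rewrite modnDml.
Qed.

(* Multiplying by q modulo q^m - 1 shifts the exponents cyclically, so each of
   the m shifted sums is at least q^m - 1; on average over the shifts, a power
   q^t contributes (q^m - 1) / (m (q - 1)). *)
Lemma dvdn_sum_exp (q m : nat) (s : seq nat) : (1 < q)%N -> (0 < m)%N ->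
  (0 < size s)%N -> (q ^ m - 1 %| \sum_(t <- s) q ^ t)%N ->
  (m * (q - 1) <= size s)%N.
Proof.
move=> q1 m0 s0 dv; set n := (q ^ m - 1)%N in dv.
have n0 : (0 < n)%N by rewrite subn_gt0 -(exp1n m) ltn_exp2r.
have qm : (q ^ m = 1 %[mod n])%N.
  by rewrite -(@subnK 1 (q ^ m)) ?expn_gt0 ?(ltnW q1) // -/n -modnDml modnn.
have qmk k : ((q ^ m) ^ k = 1 %[mod n])%N by rewrite -modnXm qm modnXm exp1n.
have qt t : (q ^ (t %% m) = q ^ t %[mod n])%N.
  rewrite [in RHS](div.divn_eq t m) expnD -modnMml (mulnC (t %/ m)%N) expnM qmk.
  by rewrite modnMml mul1n.
have shift j : (n <= \sum_(t <- s) q ^ ((t + j) %% m))%N.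
  apply: dvdn_leq.
    case: s s0 {dv} => // t s _; rewrite big_cons addn_gt0 expn_gt0 (ltnW q1) //.
  rewrite /dvdn -modn_summ.
  under eq_bigr do rewrite qt expnD.
  by rewrite modn_summ -big_distrl /= -modnMml (eqP dv) mod0n.
have : (\sum_(j < m) n <= \sum_(j < m) \sum_(t <- s) q ^ ((t + j) %% m))%N.
  by apply: leq_sum => j _.
rewrite sum_nat_const card_ord exchange_big /=.
under eq_bigr do rewrite sum_exp_cyclic_shift //.
rewrite big_const_seq count_predT iter_addn_0 => le.
rewrite -(leq_pmul2r n0) mulnAC.
apply: leq_trans (leq_mul le (leqnn _)) _.
(* A factor q - 1 turns the geometric sum in [le] back into [n]. *)
have -> : (n = (q - 1) * \sum_(j < m) q ^ j)%N by rewrite /n !subn1 predn_exp.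
by rewrite -mulnA mulnC -mulnA.
Qed.

(** Bounds the exponents of the conjugates of [xi]. Here [i < j] provides [0 < j]: for j = 0, q = 2,
    m = 1 both sides are 1. *)
Lemma ltn_exp_predn (q m i j : nat) :
  (1 < q)%N -> (i < j)%N -> (j < m)%N -> (q ^ j < q ^ m - 1)%N.
Proof.
move=> q_gt1 lt_ij lt_jm; rewrite ltn_subRL.
have le_jm : (q ^ j * 2 <= q ^ m)%N.
  by apply: leq_trans (_ : q ^ j.+1 <= _)%N; rewrite ?leq_exp2l // expnSr leq_mul.
apply: leq_trans le_jm; rewrite muln2 -addnn ltn_add2r -[1%N](expn0 q).
by rewrite ltn_exp2l // (leq_trans _ lt_ij).
Qed.

(** * Roots of unity in a ring [R] over a field [K] *)

Section UnitsModNilpotents.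

Variables (R : comNzRingType) (K : fieldType) (phi : {rmorphism R -> K}).
Hypothesis phi_reg : forall x y : R, phi x != 0 -> x * y = 0 -> y = 0.

Variable n : nat.
Hypothesis n_neq0 : n%:R != 0 :> K.

(** The cofactor of u - v in u^n - v^n = 0 maps to n phi(u)^(n-1), which is nonzero, so it can be
    cancelled. *)
Lemma unity_root_lift_inj (u v : R) :
  u ^+ n = 1 -> v ^+ n = 1 -> phi u = phi v -> u = v.
Proof.
move=> un vn uv; apply/eqP; rewrite -subr_eq0; apply/eqP.
have n_nz : n != 0%N by apply: contraNneq n_neq0 => ->.
have phiu : phi u != 0.
  apply/eqP => phiu0; have := congr1 phi un; rewrite rmorphXn phiu0 rmorph1.
  by move/eqP; rewrite expr0n (negPf n_nz) eq_sym oner_eq0.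
have : (\sum_(i < n) u ^+ (n.-1 - i) * v ^+ i) * (u - v) = 0.
  by rewrite mulrC -subrXX un vn subrr.
apply: phi_reg; rewrite rmorph_sum.
rewrite (eq_bigr (fun=> phi u ^+ n.-1)) => [|i _].
  by rewrite sumr_const card_ord -mulr_natr mulf_neq0 ?expf_neq0.
rewrite rmorphM !rmorphXn -uv -exprD subnK // -ltnS prednK //.
by apply: leq_ltn_trans (ltn_ord i).
Qed.

Variable xi : R.
Hypothesis xi_prim : n.-primitive_root xi.

Let n_gt0 : (0 < n)%N := prim_order_gt0 xi_prim.

Lemma phi_prim_root_inj i j : phi (xi ^+ i) = phi (xi ^+ j) -> i = j %[mod n].
Proof.
move=> eq_ij; apply/eqP; rewrite -(eq_prim_root_expr xi_prim); apply/eqP.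
by apply: unity_root_lift_inj => //; rewrite exprAC (prim_expr_order xi_prim) expr1n.
Qed.

(** Multiplying by [xi ^+ e - 1] telescopes the sum to 0, and this factor is cancellable because
    [xi] keeps its order in [K]. *)
Lemma prim_root_power_sum e : ~~ (n %| e)%N -> \sum_(i < n) xi ^+ (i * e) = 0.
Proof.
move=> ndvd; apply: (@phi_reg (xi ^+ e - 1)).
  rewrite rmorphB rmorph1 subr_eq0; apply: contra ndvd => /eqP phi1.
  have /phi_prim_root_inj : phi (xi ^+ e) = phi (xi ^+ 0) by rewrite phi1 rmorph1.
  by rewrite mod0n => /eqP.
under eq_bigr do rewrite mulnC exprM.
by rewrite -subrX1 exprAC (prim_expr_order xi_prim) expr1n subrr.
Qed.

Variables (q m : nat) (x : nat -> 'I_m -> R).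
Hypothesis n_def : n = (q ^ m - 1)%N.

(* [x i] are the coordinates of [xi ^+ i], which its conjugates share. *)
Hypothesis x_conj : forall i t : nat, (i < n)%N -> (t < m)%N ->
  (xi ^+ i) ^+ (q ^ t) = \sum_(j < m) x i j * (xi ^+ j) ^+ (q ^ t).

Let q_gt1 : (1 < q)%N.
Proof.
move: n_gt0; rewrite n_def subn_gt0; case: q => [|[|q']] //.
  by case: m => [|m']; rewrite ?expn0 ?exp0n.
by rewrite exp1n.
Qed.

Let V : 'M[R]_m := Vandermonde m (\row_(t < m) xi ^+ (q ^ t)).

(** The determinant is a product of differences of the xi^(q^t), t < m. Their exponents are distinct
    and less than n, so they stay distinct in [K]. *)
Lemma phi_det_conj : phi (\det V) != 0.
Proof.
rewrite det_Vandermonde rmorph_prod; apply/prodf_neq0 => i _.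
rewrite rmorph_prod; apply/prodf_neq0 => j lt_ij.
rewrite !mxE rmorphB subr_eq0; apply/eqP => /phi_prim_root_inj.
have lt_q : (q ^ i < q ^ j)%N by rewrite ltn_exp2l.
have lt_n : (q ^ j < n)%N by rewrite n_def (ltn_exp_predn _ lt_ij).
by rewrite !modn_small // => [eq_q|]; [rewrite eq_q ltnn in lt_q | apply: ltn_trans lt_n].
Qed.

(** The list [s] holds the variables of a monomial with multiplicity, so that expanding the product
    amounts to choosing a conjugate [f k] for each position [k]. *)
Lemma monomial_power_sum (s : seq 'I_m) :
  (0 < size s < m * (q - 1))%N -> \sum_(i < n) \prod_(j <- s) x i j = 0.
Proof.
case/andP=> s_gt0 s_lt.
have m_gt0 : (0 < m)%N by move: (leq_ltn_trans (leq0n _) s_lt); rewrite muln_gt0 => /andP[].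
(* Cramer's rule; the power of [\det V] that builds up is cancelled by regularity instead of
   inverted. *)
have xE i j : (i < n)%N ->
    \det V * x i j = \sum_(t < m) (xi ^+ i) ^+ (q ^ t) * \adj V t j.
  move=> lt_in; have : \row_j x i j *m V = \row_t (xi ^+ i) ^+ (q ^ t).
    apply/rowP => t; rewrite !mxE x_conj //.
    by apply: eq_bigr => k _; rewrite !mxE exprAC.
  move/(congr1 (fun u => (u *m \adj V) 0 j)).
  rewrite -mulmxA mul_mx_adj mul_mx_scalar !mxE => ->.
  by apply: eq_bigr => t _; rewrite mxE.
have phi_detX : phi (\det V ^+ size s) != 0.
  by rewrite rmorphXn expf_neq0 ?phi_det_conj.
apply: (phi_reg phi_detX).
pose e (f : {ffun 'I_(size s) -> 'I_m}) := (\sum_k q ^ f k)%N.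
pose w (f : {ffun 'I_(size s) -> 'I_m}) := \prod_k \adj V (f k) (tnth (in_tuple s) k).
rewrite mulr_sumr (eq_bigr (fun i : 'I_n => \sum_f w f * xi ^+ (i * e f))).
  rewrite exchange_big big1 // => f _; rewrite -mulr_sumr prim_root_power_sum ?mulr0 //.
  apply: contraL s_lt => dvd_n; rewrite -leqNgt.
  have := @dvdn_sum_exp q m [seq val (f k) | k <- enum 'I_(size s)].
  rewrite size_map size_enum_ord big_map big_enum -n_def; exact.
move=> i _; rewrite big_tnth -[X in \det V ^+ X]card_ord -prodr_const -big_split /=.
under eq_bigr do rewrite xE //.
rewrite bigA_distr_bigA; apply: eq_bigr => f _ /=.
by rewrite big_split /= mulrC exprM expr_sum.
Qed.

End UnitsModNilpotents.

(** * Frobenius powers and the residue field of [L] *)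

(** Raising to the power |F|^t is additive in characteristic p and fixes the coefficients, which
    come from [F]. *)
Lemma horner_map_exp_card (F : finFieldType) (K : fieldType)
    (iota : {rmorphism F -> K}) (p r : nat) (P : {poly F}) (y : K) (t : nat) :
  prime p -> #|F| = (p ^ r)%N ->
  (map_poly iota P).[y ^+ (#|F| ^ t)] = (map_poly iota P).[y] ^+ (#|F| ^ t).
Proof.
move=> p_pr cardF.
have pK : p \in [pchar K] by rewrite (rmorph_pchar iota) // (card_finPcharP cardF p_pr).
have qK : [pchar K].-nat (#|F| ^ t)%N.
  rewrite cardF -expnM pnatX orbC; apply/orP; right.
  by rewrite pnatE.
have expF (c : F) : c ^+ (#|F| ^ t) = c.
  by elim: t {qK} => [|t IHt]; rewrite ?expr1 // expnSr exprM IHt expf_card.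
elim/poly_ind: P => [|P c IHP].
  by rewrite rmorph0 !horner0 expr0n expn_eq0 eqn0Ngt (ltnW (finNzRing_gt1 F)).
rewrite rmorphD rmorphM /= map_polyX map_polyC !hornerE IHP exprDn_pchar //.
by rewrite exprMn -rmorphXn expF.
Qed.

Section ResidueField.

Variables (p s r : nat) (L : finComUnitRingType) (F : finFieldType).
Variable pi : {rmorphism L -> F}.
Hypotheses (p_pr : prime p) (s_gt0 : (0 < s)%N).
Hypotheses (L_galois : galois_ring p s r L) (pi_res : residue_map p pi).

Lemma residue_unit (x : L) : (x \is a GRing.unit) = (pi x != 0).
Proof.
apply/idP/idP => [|pix]; first by move/(rmorph_unit pi); rewrite unitfE.
apply: contraNT pix => /(galois_ring_local L_galois)/pi_res.2 ->.
by rewrite eqxx.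
Qed.

Lemma galois_ring_nilp : p%:R ^+ s = 0 :> L.
Proof. by rewrite -natrX; apply/(galois_ring_char L_galois). Qed.

Lemma galois_ring_expp_neq0 j : (j < s)%N -> p%:R ^+ j != 0 :> L.
Proof.
move=> lt_js; apply/eqP; rewrite -natrX => /(galois_ring_char L_galois).
by rewrite dvdn_Pexp2l ?prime_gt1 // leqNgt lt_js.
Qed.

(* Multiplication by p^j shows |p^j L| = |F| |p^(j+1) L| for j < s. *)
Lemma card_residue_field : #|F| = (p ^ r)%N.
Proof.
(* A section of [pi]; surjectivity rules out the default 0. *)
pose tau (a : F) : L := odflt 0 [pick x | pi x == a].
have tauK a : pi (tau a) = a.
  rewrite /tau; case: pickP => [x /eqP //|none].
  by have [x pix] := pi_res.1 a; have := none x; rewrite pix eqxx.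
pose J j := [set p%:R ^+ j * x | x : L].
have cardJ j : (j < s)%N -> #|J j| = (#|F| * #|J j.+1|)%N.
  move=> lt_js; pose f (u : F * L) := p%:R ^+ j * tau u.1 + u.2.
  have -> : J j = f @: setX setT (J j.+1).
    apply/setP => z; apply/imsetP/imsetP => [[x _ ->]|[[a y]]].
      have [|y def_y] := (pi_res.2 (x - tau (pi x))).1.
        by rewrite rmorphB tauK subrr.
      exists (pi x, p%:R ^+ j.+1 * y); first by apply/setXP; split; last exact: imset_f.
      by rewrite /f /= exprSr -mulrA -def_y -mulrDr addrC subrK.
    case/setXP => _ /= /imsetP[y' _ ->] ->.
    by exists (tau a + p%:R * y') => //; rewrite /f /= mulrDr mulrA -exprSr.
  rewrite card_in_imset ?cardsX ?cardsT //.
  move=> [a y] [a' y'] /setXP[_ /imsetP[z _ ->]] /setXP[_ /imsetP[z' _ ->]].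
  rewrite /f /= => eq_f; suff eq_a : a = a'.
    by move: eq_f; rewrite eq_a => /addrI ->.
  apply/eqP; apply: contraNT (galois_ring_expp_neq0 lt_js) => ne_a.
  (* For a <> a', equal values of [f] would make p^j times this unit vanish, although j < s. *)
  have uU : tau a - tau a' + p%:R * (z - z') \is a GRing.unit.
    rewrite residue_unit rmorphD rmorphB !tauK.
    by rewrite (pi_res.2 _).2 ?addr0 ?subr_eq0 //; exists (z - z').
  rewrite -(mulIr_eq0 _ (mulIr uU)) mulrDr mulrA -exprSr !mulrBr.
  by rewrite addrACA -opprD eq_f subrr.
have J0 : J 0%N = setT.
  by apply/setP => x; rewrite inE; apply/imsetP; exists x; rewrite // mul1r.
have Js : J s = [set 0].
  apply/setP => x; rewrite inE; apply/imsetP/eqP => [[y _ ->]|->].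
    by rewrite galois_ring_nilp mul0r.
  by exists 0; rewrite ?mulr0.
have cardL j : (j <= s)%N -> #|L| = (#|F| ^ j * #|J j|)%N.
  elim: j => [|j IHj] lt_js; first by rewrite mul1n J0 cardsT.
  by rewrite (IHj (ltnW lt_js)) cardJ // mulnA expnSr.
have := cardL s (leqnn s); rewrite Js cards1 muln1 (galois_ring_card L_galois).
by rewrite mulnC expnM => /eqP; rewrite eqn_exp2r // => /eqP.
Qed.

End ResidueField.

(** * The ring L[X]/h, its reduction modulo p and its Frobenius *)

Section PrimitiveQuotient.

Variables (p s r m : nat) (L : finComUnitRingType) (F : finFieldType).
Variable pi : {rmorphism L -> F}.
Hypotheses (p_pr : prime p) (s_gt0 : (0 < s)%N) (r_gt0 : (0 < r)%N) (m_gt0 : (0 < m)%N).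
Hypotheses (L_galois : galois_ring p s r L) (pi_res : residue_map p pi).

Variables (h g : {poly L}) (K : fieldExtType F) (a : K).
Hypotheses (h_monic : h \is monic) (size_h : size h = m.+1).
Hypotheses (dimK : \dim {:K} = m).
Hypothesis h_minPoly : map_poly (in_alg K) (map_poly pi h) = minPoly 1%AS a.

Local Notation q := (p ^ r)%N.
Local Notation n := ((p ^ r) ^ m - 1)%N.
Local Notation R := {poly %/ h}.

Hypothesis gh : 'X^n - 1 = g * h.

Let cardF : #|F| = q := card_residue_field p_pr s_gt0 L_galois pi_res.

Let qm_gt1 : (1 < q ^ m)%N.
Proof. by rewrite -(exp1n m) ltn_exp2r // -cardF finNzRing_gt1. Qed.

Let n_gt0 : (0 < n)%N.
Proof. by rewrite subn_gt0. Qed.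

Let psi : {rmorphism L -> K} := in_alg K \o pi.

Let mk_monic_h : mk_monic h = h.
Proof. by rewrite /mk_monic size_h ltnS m_gt0 h_monic. Qed.

Let psi_h : map_poly psi h = minPoly 1%AS a.
Proof. by rewrite map_poly_comp. Qed.

(** Reduction of [R] modulo p, with X going to [a]. It respects products because [h] reduces to the
    minimal polynomial of [a]. *)
Definition residue_eval (f : R) : K := (map_poly psi f).[a].

Lemma residue_eval_in_qpoly (P : {poly L}) :
  residue_eval (in_qpoly h P) = (map_poly psi P).[a].
Proof.
rewrite /residue_eval /= mk_monic_h [in RHS](Pdiv.RingMonic.rdivp_eq h_monic P).
by rewrite rmorphD rmorphM /= hornerD hornerM psi_h minPolyxx mulr0 add0r.
Qed.

Lemma residue_eval_is_zmod_morphism : zmod_morphism residue_eval.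
Proof. by move=> x y; rewrite /residue_eval /= raddfB hornerD hornerN. Qed.

Lemma in_qpoly_val (f : R) : in_qpoly h f = f.
Proof. by apply/val_inj/in_qpoly_small/size_mk_monic. Qed.

Lemma residue_eval_is_monoid_morphism : monoid_morphism residue_eval.
Proof.
split=> [|x y]; first by rewrite -in_qpoly1 residue_eval_in_qpoly rmorph1 hornerC.
rewrite -[x in LHS]in_qpoly_val -[y in LHS]in_qpoly_val -in_qpolyM.
by rewrite residue_eval_in_qpoly rmorphM hornerM.
Qed.

HB.instance Definition _ :=
  GRing.isZmodMorphism.Build R K residue_eval residue_eval_is_zmod_morphism.
HB.instance Definition _ :=
  GRing.isMonoidMorphism.Build R K residue_eval residue_eval_is_monoid_morphism.

(** The reduced representative has degree less than m and vanishes at [a], whose minimal polynomial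
    has degree m, so it is zero. Hence p divides x, and p^s = 0. *)
Lemma residue_eval_ker_nilp (x : R) : residue_eval x = 0 -> x ^+ s = 0.
Proof.
move=> x0; pose P : {poly F} := map_poly pi x.
have P0 : P = 0.
  apply/eqP; rewrite -(map_poly_eq0 (in_alg K)); apply: contraTT isT => nzP.
  have : minPoly 1%AS a %| map_poly (in_alg K) P.
    rewrite minPoly_dvdp //; last by rewrite /root -map_poly_comp; apply/eqP.
    by apply/polyOver1P; exists P.
  move/(dvdp_leq nzP); rewrite -psi_h size_map_poly_id0 ?size_h; last first.
    by rewrite (monicP h_monic) rmorph1 oner_eq0.
  rewrite size_map_poly /P ltnNge (leq_trans (size_poly _ _)) //.
  by rewrite -ltnS -size_h -{2}mk_monic_h size_mk_monic.
(* Divides a coefficient by p; all coefficients of [x] reduce to 0, so the default is not reached on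
   them. *)
pose d (c : L) := odflt 0 [pick y | c == p%:R * y].
have xE : x = p%:R *: in_qpoly h (\poly_(i < size (x : {poly L})) d (x : {poly L})`_i).
  rewrite -in_qpolyZ -[LHS]in_qpoly_val; congr (in_qpoly h _).
  apply/polyP => i; rewrite coefZ coef_poly; case: ltnP => [_|le]; last first.
    by rewrite mulr0 nth_default.
  rewrite /d; case: pickP => [y /eqP //|none].
  have [|y def_y] := (pi_res.2 (x : {poly L})`_i).1.
    by move/(congr1 (fun Q : {poly F} => Q`_i)): P0; rewrite coef_map coef0.
  by have := none y; rewrite def_y eqxx.
by rewrite xE exprZn (galois_ring_nilp L_galois) scale0r.
Qed.

(* By Fermat, x^n - 1 lies in the kernel, so it is nilpotent. *)
Lemma residue_eval_reg (x y : R) : residue_eval x != 0 -> x * y = 0 -> y = 0.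
Proof.
move=> phix xy; pose w := x ^+ n - 1.
have w_nilp : w ^+ s = 0.
  apply: residue_eval_ker_nilp; rewrite rmorphB rmorphXn rmorph1 /=.
  apply/eqP; rewrite subr_eq0; apply/eqP/(mulIf phix); rewrite mul1r -exprSr.
  rewrite -addn1 subnK ?(ltnW qm_gt1) // -cardF -dimK.
  by apply/eqP; rewrite -(Fermat's_little_theorem {:K}%AS) memvf.
(* As x y = 0, multiplication by -w fixes y, and so does its s-th power, which is 0. *)
have wy : (- w) * y = y.
  rewrite mulNr mulrBl mul1r -(prednK n_gt0) exprSr -mulrA xy mulr0 sub0r.
  by rewrite opprK.
have wky k : (- w) ^+ k * y = y.
  by elim: k => [|k IHk]; rewrite ?mul1r // exprS -mulrA IHk.
by rewrite -(wky s) exprNn w_nilp mulr0 mul0r.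
Qed.

(** In characteristic p, q^m - 1 is -1. *)
Lemma natr_card_pred_neq0 : n%:R != 0 :> K.
Proof.
have pK : p \in [pchar K].
  by rewrite (rmorph_pchar (in_alg K)) // (card_finPcharP cardF p_pr).
rewrite natrB ?(ltnW qm_gt1) // -expnM natrX (pcharf0 pK) expr0n.
by rewrite muln_eq0 !eqn0Ngt r_gt0 m_gt0 sub0r oppr_eq0 oner_eq0.
Qed.

(* Evaluation at X^(q^t) in place of X: it induces the t-th power of the
   Frobenius automorphism of R over L. *)
Definition twisted_eval (t : nat) (P : {poly L}) : R :=
  (map_poly (in_alg R) P).[in_qpoly h 'X ^+ (q ^ t)].

Lemma residue_twisted_eval t P :
  residue_eval (twisted_eval t P) = residue_eval (in_qpoly h P) ^+ (q ^ t).
Proof.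
have phiA c : residue_eval c%:A = psi c.
  by rewrite -in_qpoly1 -in_qpolyZ residue_eval_in_qpoly alg_polyC map_polyC hornerC.
rewrite -horner_map rmorphXn /= !residue_eval_in_qpoly map_polyX hornerX.
rewrite -map_poly_comp (eq_map_poly phiA) /psi map_poly_comp -cardF.
by rewrite (horner_map_exp_card _ _ _ _ p_pr cardF).
Qed.

Lemma qpolyX_unity_root : (in_qpoly h 'X) ^+ n = 1.
Proof.
apply/eqP; rewrite -subr_eq0 -rmorphXn -in_qpoly1 -rmorphB gh rmorphM /=.
suff -> : in_qpoly h h = 0 by rewrite mulr0.
by apply: val_inj; rewrite /= mk_monic_h Pdiv.RingMonic.rmodpp.
Qed.

(** Separability of X^n - 1: differentiating at [a] gives n a^(n-1) = g(a) h'(a), and neither n nor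
    [a] is zero in [K]. *)
Lemma residue_eval_cofactor : residue_eval (in_qpoly h g) != 0.
Proof.
have := congr1 (fun P => (map_poly psi P^`()).[a]) gh.
rewrite derivB derivXn derivC subr0 derivM rmorphD !rmorphM /= hornerD !hornerM.
rewrite psi_h minPolyxx mulr0 add0r -(residue_eval_in_qpoly g) => eq_n.
apply: contraNneq natr_card_pred_neq0 => g0; move: eq_n; rewrite g0 mul0r.
rewrite rmorphMn /= map_polyXn hornerMn hornerXn -mulr_natl.
move/eqP; rewrite mulf_eq0 => /orP[//|]; rewrite expf_eq0 => /andP[_ /eqP a0].
have := congr1 residue_eval qpolyX_unity_root.
rewrite rmorphXn rmorph1 /= residue_eval_in_qpoly map_polyX hornerX a0 expr0n.
by rewrite gtn_eqF // => /eqP; rewrite eq_sym oner_eq0.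
Qed.

(** This lets twisted evaluation descend to [R]. At X^(q^t) the product g h = X^n - 1 vanishes while
    g is cancellable, so X^(q^t) is a root of h. *)
Lemma twisted_eval_eq0 t P : in_qpoly h P = 0 -> twisted_eval t P = 0.
Proof.
move/(congr1 (fun f : R => f : {poly L})); rewrite /= mk_monic_h => P0.
have h0 : twisted_eval t h = 0.
  apply: (@residue_eval_reg (twisted_eval t g)).
    by rewrite residue_twisted_eval expf_neq0 // residue_eval_cofactor.
  rewrite /twisted_eval -hornerM -rmorphM /= -gh rmorphB rmorph1 /= map_polyXn.
  by rewrite hornerD hornerN hornerXn hornerC exprAC qpolyX_unity_root expr1n subrr.
rewrite (Pdiv.RingMonic.rdivp_eq h_monic P) P0 addr0.
by rewrite /twisted_eval rmorphM hornerM [X in _ * X]h0 mulr0.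
Qed.

Variables (xi : R) (b : nat -> 'I_m -> L).
Hypothesis xi_prim : n.-primitive_root xi.
Hypothesis b_coords : power_coords n xi b.

(** As [xi] need not be the class of X, this takes an argument: both sides are n-th roots of unity
    with the same residue. *)
Lemma twisted_eval_xi t : twisted_eval t xi = xi ^+ (q ^ t).
Proof.
apply: (unity_root_lift_inj residue_eval_reg natr_card_pred_neq0).
- apply/eqP; rewrite -subr_eq0; apply/eqP.
  transitivity (twisted_eval t ((xi : {poly L}) ^+ n - 1)).
    by rewrite /twisted_eval rmorphB rmorphXn rmorph1 /= !hornerE.
  apply: twisted_eval_eq0; rewrite rmorphB rmorphXn rmorph1 /= in_qpoly_val.
  by rewrite (prim_expr_order xi_prim) subrr.
- by rewrite exprAC (prim_expr_order xi_prim) expr1n.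
by rewrite /= residue_twisted_eval in_qpoly_val -rmorphXn.
Qed.

(** The Frobenius is L-linear, so it carries the coordinate relation of [xi ^+ i] to its
    conjugates. *)
Lemma conj_power_coords i t : (i < n)%N ->
  (xi ^+ i) ^+ (q ^ t) = \sum_(j < m) (b i j)%:A * (xi ^+ j) ^+ (q ^ t).
Proof.
move=> lt_in; pose X : {poly L} := xi.
have : twisted_eval t (X ^+ i - \sum_(j < m) b i j *: X ^+ j) = 0.
  apply: twisted_eval_eq0; rewrite rmorphB rmorphXn /= in_qpoly_val raddf_sum.
  rewrite b_coords //; apply/eqP; rewrite subr_eq0; apply/eqP/eq_bigr => j _.
  by rewrite /= in_qpolyZ rmorphXn /= in_qpoly_val.
rewrite /twisted_eval rmorphB rmorphXn /= hornerD hornerN horner_exp.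
rewrite -/(twisted_eval t X) twisted_eval_xi exprAC => /eqP.
rewrite subr_eq0 => /eqP ->; rewrite rmorph_sum horner_sum; apply: eq_bigr => j _.
rewrite /= map_polyZ hornerZ rmorphXn /= horner_exp -/(twisted_eval t X).
by rewrite twisted_eval_xi exprAC.
Qed.

Lemma monomial_coords_power_sum (u : seq 'I_m) :
  (0 < size u < m * (q - 1))%N -> \sum_(i < n) \prod_(j <- u) b i j = 0.
Proof.
move=> size_u; have alg_inj : injective (in_alg R).
  move=> x y /(congr1 (fun f : R => (f : {poly L})`_0)) /=.
  by rewrite !coefZ coefC !mulr1.
apply: alg_inj.
rewrite rmorph0 rmorph_sum.
under eq_bigr do rewrite rmorph_prod.
have x_conj i t (lt_in : (i < n)%N) (_ : (t < m)%N) := conj_power_coords t lt_in.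
exact: (monomial_power_sum residue_eval_reg natr_card_pred_neq0 xi_prim (erefl n) x_conj).
Qed.

(** Coordinates modulo p determine the residue of a power of [xi]; these residues are nonzero, which
    separates them from the point 0, and distinct for exponents below n. *)
Lemma residue_point_inj k l : (k < q ^ m)%N -> (l < q ^ m)%N ->
  (forall j, pi (point b k j) = pi (point b l j)) -> k = l.
Proof.
have phiE i : (i < n)%N ->
    residue_eval (xi ^+ i) = \sum_(j < m) in_alg K (pi (b i j)) * residue_eval xi ^+ j.
  move=> lt_in; rewrite b_coords // rmorph_sum; apply: eq_bigr => j _ /=.
  rewrite -{1}[xi ^+ j]mul1r scalerAl rmorphM rmorphXn /=; congr (_ * _).
  by rewrite -in_qpoly1 -in_qpolyZ residue_eval_in_qpoly alg_polyC map_polyC hornerC.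
have lt_n i : (i.+1 < q ^ m)%N -> (i < n)%N by rewrite ltn_subRL.
have phi_neq0 i : residue_eval (xi ^+ i) != 0.
  have : residue_eval (xi ^+ i) ^+ n = 1.
    by rewrite -rmorphXn exprAC (prim_expr_order xi_prim) expr1n rmorph1.
  apply: contra_eqN => /eqP ->.
  by rewrite expr0n gtn_eqF // eq_sym oner_eq0.
have not0 i : (i < n)%N -> ~ forall j, pi (b i j) = 0.
  move=> lt_in bi0; case/eqP: (phi_neq0 i); rewrite phiE // big1 // => j _.
  by rewrite bi0 rmorph0 mul0r.
case: k l => [|k] [|l] //=.
- by move=> _ /lt_n lt_l eq_b; case: (not0 _ lt_l) => j; rewrite -eq_b rmorph0.
- by move=> /lt_n lt_k _ eq_b; case: (not0 _ lt_k) => j; rewrite eq_b rmorph0.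
move=> /lt_n lt_k /lt_n lt_l eq_b.
congr _.+1; rewrite -[k](modn_small lt_k) -[l](modn_small lt_l).
apply: (phi_prim_root_inj residue_eval_reg natr_card_pred_neq0 xi_prim).
by rewrite /= !phiE //; apply: eq_bigr => j _; rewrite eq_b.
Qed.

End PrimitiveQuotient.

(** * Evaluation codes and the two inclusions *)

Section EvaluationCodes.

Variables (q m : nat) (L : finComUnitRingType) (F : finFieldType).
Variables (pi : {rmorphism L -> F}) (b : nat -> 'I_m -> L).
Hypothesis unitL : forall x : L, pi x != 0 -> x \is a GRing.unit.
Hypothesis cardF : #|F| = q.
Hypothesis pi_point_inj : forall k l : 'I_(q ^ m),
  (forall j, pi (point b k j) = pi (point b l j)) -> k = l.
Hypothesis monomial_sum : forall M : 'X_{1..m}, (mdeg M < m * (q - 1))%N ->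
  \sum_(k < q ^ m) ('X_[M] : {mpoly L[m]}).@[point b k] = 0.

Lemma meval_sum_point (P : {mpoly L[m]}) :
    (forall M : 'X_{1..m}, M \in msupp P -> (mdeg M < m * (q - 1))%N) ->
  \sum_(k < q ^ m) P.@[point b k] = 0.
Proof.
move=> deg_P; under eq_bigr do rewrite mevalE.
rewrite exchange_big big1_seq => // M /andP[_ MP].
rewrite -mulr_sumr; under eq_bigr do rewrite -mevalX.
by rewrite monomial_sum ?mulr0 // deg_P.
Qed.

(** The inner product sums the values of a product of polynomials. That product need not be reduced
    in each variable, but its total degree is below m(q - 1). *)
Lemma RM_dual (mu nu : nat) (c : 'rV[L]_(q ^ m)) :
  (mu + nu < m * (q - 1))%N -> RM mu b c -> dual_code (RM nu b) c.
Proof.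
move=> lt_mn [P [_ size_P ->]] _ [Q [_ size_Q ->]].
under eq_bigr do rewrite !mxE -mevalM.
apply: meval_sum_point => _ /msuppM_le/allpairsP[[M M'] /= [MP MQ ->]].
rewrite mdegD; apply: leq_ltn_trans lt_mn; apply: leq_add.
  by rewrite -ltnS (leq_trans (msize_mdeg_lt MP)).
by rewrite -ltnS (leq_trans (msize_mdeg_lt MQ)).
Qed.

Local Notation redexp := {ffun 'I_m -> 'I_q}.

Let q_gt1 : (1 < q)%N. Proof. by rewrite -cardF finNzRing_gt1. Qed.

Lemma card_redexp : (q ^ m)%N = #|redexp|.
Proof. by rewrite card_ffun !card_ord. Qed.

(* Codewords have length q^m, so the reduced exponents are numbered by the
   same ordinals as the points, which makes all matrices below square. *)
Definition redexp_of (k : 'I_(q ^ m)) : redexp := enum_val (cast_ord card_redexp k).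

Definition redexp_rank (f : redexp) : 'I_(q ^ m) :=
  cast_ord (esym card_redexp) (enum_rank f).

Lemma redexp_ofK : cancel redexp_of redexp_rank.
Proof. by move=> k; rewrite /redexp_rank enum_valK cast_ordK. Qed.

Lemma redexp_rankK : cancel redexp_rank redexp_of.
Proof. by move=> f; rewrite /redexp_of cast_ordKV enum_rankK. Qed.

Definition monom (k : 'I_(q ^ m)) : 'X_{1..m} :=
  [multinom (redexp_of k j : nat) | j < m].

Definition compl (k : 'I_(q ^ m)) : 'I_(q ^ m) :=
  redexp_rank [ffun j => rev_ord (redexp_of k j)].

Lemma complK : involutive compl.
Proof.
move=> k; rewrite /compl redexp_rankK -[RHS]redexp_ofK; congr redexp_rank.
by apply/ffunP => j; rewrite !ffunE rev_ordK.
Qed.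

Lemma mdeg_monom_compl k : (mdeg (monom (compl k)) + mdeg (monom k) = m * (q - 1))%N.
Proof.
rewrite !mdegE -big_split /= (eq_bigr (fun=> q - 1)%N) => [|j _].
  by rewrite sum_nat_const card_ord.
rewrite !mnmE redexp_rankK ffunE /=.
by rewrite -[q in RHS](subnK (ltn_ord (redexp_of k j))) addnS subn1.
Qed.

Lemma monom_inj : injective monom.
Proof.
move=> k l /mnmP eq_kl; apply: (can_inj redexp_ofK); apply/ffunP => j.
by apply: val_inj; have := eq_kl j; rewrite !mnmE.
Qed.

Definition eval_mx : 'M[L]_(q ^ m) := \matrix_(k, l) ('X_[monom k]).@[point b l].

(** Interpolation modulo p: the product over j of 1 - (X_j - z_kj)^(q-1) is the indicator function
    of the k-th point, so its coefficients form row k of an inverse of the reduced matrix. *)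
Lemma eval_mx_unit : eval_mx \in unitmx.
Proof.
rewrite unitmxE unitL // -det_map_mx -unitfE -unitmxE.
pose z (k : 'I_(q ^ m)) j := pi (point b k j).
pose w (k : 'I_(q ^ m)) j : {poly F} := 1 - ('X - (z k j)%:P) ^+ (q - 1).
pose X : 'M[F]_(q ^ m) := \matrix_(k, l) \prod_j (w k j)`_(redexp_of l j).
suff : X *m map_mx pi eval_mx = 1%:M by case/mulmx1_unit.
apply/matrixP => k l; rewrite !mxE.
transitivity (\sum_(f : redexp) \prod_j ((w k j)`_(f j) * z l j ^+ f j)).
  (* Indexing by functions instead of ordinals lets the sum factor over the variables. *)
  rewrite (reindex redexp_of); last first.
    by exists redexp_rank => ? _; rewrite ?redexp_ofK ?redexp_rankK.
  apply: eq_bigr => i _; rewrite !mxE big_split /= mevalX rmorph_prod.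
  by congr (_ * _); apply: eq_bigr => j _; rewrite mnmE rmorphXn.
rewrite -(bigA_distr_bigA (fun j (e : 'I_q) => (w k j)`_e * z l j ^+ e)).
have wE j : \sum_(e < q) (w k j)`_e * z l j ^+ e = (z l j == z k j)%:R.
  rewrite -horner_coef_wide.
    rewrite /w !hornerE; case: eqP => [->|/eqP ne]; rewrite ?subrr.
      by rewrite expr0n subn_eq0 leqNgt q_gt1 subr0.
    apply/eqP; rewrite subr_eq0 eq_sym; apply/eqP.
    have nz : z l j - z k j != 0 by rewrite subr_eq0.
    apply: (mulIf nz); rewrite mul1r -exprSr subn1 prednK ?(ltnW q_gt1) //.
    by rewrite -cardF expf_card.
  rewrite (leq_trans (size_polyD _ _)) // size_polyN size_exp_XsubC size_poly1.
  by rewrite geq_max subn1 (prednK (ltnW q_gt1)) (ltnW q_gt1) leqnn.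
under eq_bigr do rewrite wE.
have [->|ne_kl] := eqVneq k l; first by rewrite big1 // => j _; rewrite eqxx.
case: (pickP (fun j => z l j != z k j)) => [j ne_j|eq_z].
  by rewrite (bigD1 j) //= (negPf ne_j) mul0r.
case/eqP: ne_kl; apply: pi_point_inj => j; apply/esym/eqP.
by have /negbFE := eq_z j.
Qed.

Lemma RM_monom (nu : nat) (k : 'I_(q ^ m)) :
  (mdeg (monom k) <= nu)%N -> RM nu b (row k eval_mx).
Proof.
move=> deg_k; exists 'X_[monom k]; split.
- move=> M; rewrite msuppX inE => /eqP -> j; rewrite mnmE -ltnS subn1.
  by rewrite (prednK (ltnW q_gt1)).
- by rewrite msizeX ltnS.
by apply/rowP => l; rewrite !mxE.
Qed.

Lemma RM_span (mu : nat) (a : 'rV[L]_(q ^ m)) :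
  (forall k, (mu < mdeg (monom k))%N -> a 0 k = 0) -> RM mu b (a *m eval_mx).
Proof.
move=> a0; pose P : {mpoly L[m]} := \sum_k a 0 k *: 'X_[monom k].
have suppP M : M \in msupp P -> exists2 k, M = monom k & (mdeg M <= mu)%N.
  move/msupp_sum_le/flattenP => [_ /mapP[k _ ->] Mk]; exists k.
    by move/msuppZ_le: Mk; rewrite msuppX inE => /eqP.
  move/msuppZ_le: (Mk); rewrite msuppX inE => /eqP ->.
  rewrite leqNgt; apply/negP => /a0 ak0; move: Mk.
  by rewrite ak0 scale0r msupp0.
exists P; split.
- move=> M /suppP[k -> _] j; rewrite mnmE -ltnS subn1.
  by rewrite (prednK (ltnW q_gt1)).
- rewrite msizeE; apply/bigmax_leqP_seq => M /suppP[k _ le_mu] _.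
  by rewrite ltnS.
apply/rowP => l; rewrite !mxE raddf_sum /=; apply: eq_bigr => k _.
by rewrite mevalZ mxE.
Qed.

Lemma dual_RM (mu nu : nat) (c : 'rV[L]_(q ^ m)) :
  (mu + nu + 1 = m * (q - 1))%N -> dual_code (RM nu b) c -> RM mu b c.
Proof.
move=> sum_mn c_dual.
pose a := c *m invmx eval_mx.
have -> : c = a *m eval_mx by rewrite mulmxKV // eval_mx_unit.
(* Row l of [E'] evaluates the complement of monomial l, so [G] is the Gram matrix, and [D] below
   projects to the degrees above [mu]. *)
pose E' := row_perm (perm (can_inj complK)) eval_mx.
pose G := eval_mx *m E'^T.
pose D : 'M[L]_(q ^ m) := diag_mx (\row_k (mu < mdeg (monom k))%:R).
have G_unit : G \in unitmx.
  by rewrite unitmx_mul unitmx_tr /E' row_permE unitmx_mul unitmx_perm eval_mx_unit.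
have compl_le k : (mu < mdeg (monom k))%N -> (mdeg (monom (compl k)) <= nu)%N.
  by have := mdeg_monom_compl k; lia.
have DE (A : 'M[L]_(q ^ m)) k l : (A *m D) k l = A k l * (mu < mdeg (monom l))%:R.
  by rewrite mul_mx_diag !mxE.
suff aD : a *m D = 0.
  apply: RM_span => k lt_k; have := congr1 (fun v : 'rV_ _ => v 0 k) aD.
  by rewrite mul_mx_diag !mxE lt_k mulr1.
apply: (@block_triangular_ker _ _ G (invmx G)); first exact: mulVmx.
- apply/matrixP => k l; rewrite DE !mxE.
  by case: eqP => [->|_]; rewrite ?mulr0n ?mul0r // mulr1n -natrM mulnb andbb.
- apply/matrixP => k l; rewrite DE mulmxBl mul1mx mul_diag_mx !mxE.
  case: (ltnP mu (mdeg (monom l))) => [lt_l|_]; last by rewrite mulr0.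
  case: ltnP => [_|le_k]; first by rewrite mul1r subrr mul0r.
  rewrite mul0r subr0 mulr1.
  (* Here deg k <= mu < deg l, so the entry sums over all points a monomial of degree at most mu +
     nu, less than m(q - 1). *)
  transitivity (\sum_(i < q ^ m) ('X_[monom k + monom (compl l)] : {mpoly L[m]}).@[point b i]).
    by apply: eq_bigr => i _; rewrite !mxE permE mpolyXD mevalM.
  apply: monomial_sum; rewrite mdegD -sum_mn addn1 ltnS leq_add //.
  exact: compl_le.
(* The entries of [a *m G] are inner products of [c] with complementary monomials, which lie in the
   code of order [nu] at the columns kept by [D]. *)
have -> : a *m G = c *m E'^T by rewrite mulmxA mulmxKV ?eval_mx_unit.
apply/rowP => l; rewrite mul_mx_diag !mxE.
case: ltnP => [lt_l|_]; last by rewrite mulr0.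
rewrite mulr1 -[RHS](c_dual _ (RM_monom (compl_le l lt_l))).
by apply: eq_bigr => k _; rewrite !mxE permE.
Qed.

End EvaluationCodes.

(** * Monomial sums over all points and the duality *)

Lemma prod_flatten_nseq (R : comNzRingType) (m : nat) (y : 'I_m -> R) (M : 'I_m -> nat) :
  \prod_(j <- flatten [seq nseq (M j) j | j <- enum 'I_m]) y j = \prod_j y j ^+ M j.
Proof.
rewrite big_flatten big_map big_enum /=; apply: eq_bigr => j _.
by rewrite big_nseq -Monoid.iteropE.
Qed.

Theorem theorem7p2 (p s r m : nat) (p_prime : prime p) (s_gt0 : (0 < s)%N)
    (r_gt0 : (0 < r)%N) (m_gt0 : (0 < m)%N) (s_le_rm : (s <= r * m)%N)
    (q : nat) (q_def : q = (p ^ r)%N)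
    (L : finComUnitRingType) (L_galois : galois_ring p s r L)
    (h : {poly L}) (h_prim : monic_basic_primitive p m h)
    (h_dvd : exists g : {poly L}, 'X^(q ^ m - 1) - 1 = g * h)
    (xi : {poly %/ h}) (xi_root : root (map_poly (in_alg {poly %/ h}) h) xi)
    (xi_order : (q ^ m - 1)%N.-primitive_root xi)
    (b : nat -> 'I_m -> L) (b_coords : power_coords (q ^ m - 1) xi b)
    (nu : nat) (nu_lt : (nu < m * (q - 1))%N) :
  forall c : 'rV[L]_(q ^ m),
    dual_code (RM nu b) c <-> RM (m * (q - 1) - nu - 1) b c.
Proof.
subst q; have [h_monic size_h [F [pi [pi_res [K [a [dimK _ h_minPoly]]]]]]] := h_prim.
have [g gh] := h_dvd.
have cardF := card_residue_field p_prime s_gt0 L_galois pi_res.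
have unitL x : pi x != 0 -> x \is a GRing.unit by rewrite (residue_unit L_galois pi_res).
have point_inj (k l : 'I_((p ^ r) ^ m)) :
    (forall j, pi (point b k j) = pi (point b l j)) -> k = l.
  move=> eq_kl; apply: val_inj.
  exact: (residue_point_inj p_prime s_gt0 r_gt0 m_gt0 L_galois pi_res h_monic size_h dimK
           h_minPoly xi_order b_coords (ltn_ord k) (ltn_ord l)).
have mono_sum (M : 'X_{1..m}) : (mdeg M < m * (p ^ r - 1))%N ->
    \sum_(k < (p ^ r) ^ m) ('X_[M] : {mpoly L[m]}).@[point b k] = 0.
  move=> lt_M; have [M0|M_gt0] := posnP (mdeg M).
    have /eqP -> : M == 0%MM by rewrite -mdeg_eq0 M0.
    under eq_bigr do rewrite mpolyX0 meval1.
    (* The constant 1 sums to p^(rm), a multiple of p^s because s <= rm. *)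
    rewrite sumr_const card_ord; apply/(galois_ring_char L_galois).
    by rewrite -expnM dvdn_exp2l.
  rewrite -(big_mkord xpredT (fun k => ('X_[M] : {mpoly L[m]}).@[point b k])).
  (* Index 0 is the point 0, where a monomial of positive degree vanishes; the other n points are
     the b_i. *)
  rewrite -(@subnK 1 ((p ^ r) ^ m)) ?expn_gt0 ?prime_gt0 // addn1 big_nat_recl //.
  rewrite big_mkord mevalX /=; have [j Mj|M0] := pickP (fun j => M j != 0%N); last first.
    by move: M_gt0; rewrite mdegE big1 // => j _; apply/eqP/negbFE/M0.
  rewrite (bigD1 j) //= expr0n (negPf Mj) mul0r add0r.
  under eq_bigr do rewrite mevalX -prod_flatten_nseq.
  apply: (monomial_coords_power_sum p_prime s_gt0 r_gt0 m_gt0 L_galois pi_res h_monic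
           size_h dimK h_minPoly gh xi_order b_coords).
  rewrite size_flatten /shape -map_comp sumnE big_map big_enum /=.
  under eq_bigr do rewrite size_nseq.
  by rewrite -mdegE M_gt0.
move=> c; split.
  apply: (dual_RM unitL cardF point_inj mono_sum); lia.
apply: (RM_dual mono_sum); lia.
Qed.
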